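(* Let $n\geq 7$ be an odd integer and let $G\in \mathfrak{C}_{n,n-4}\left(\frac{n-1}{2}\right)$. Then $W(G)\leq W(C_n)$.
   Context: All graphs are finite, connected, undirected, without loops or parallel edges. The Wiener index $W(G)$ of a graph $G$ is the sum of the distances between all unordered pairs of vertices of $G$. A cut vertex of $G$ is a vertex whose removal makes the graph disconnected. $\mathfrak{C}_{n,k}(d)$ denotes the family of all (connected) graphs on $n$ vertices with exactly $k$ cut vertices and diameter $d$. $C_n$ is the cycle on $n$ vertices. *)

(* Defs.v *)
From mathcomp Require Import all_boot.

Set Implicit Arguments.
Unset Strict Implicit.
Unset Printing Implicit Defensive.

Record sgraph := SGraph {
  vertex :> finType;
  adj : rel vertex;
  adj_sym : symmetric adj;
  adj_irr : irreflexive adj }.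

Arguments adj {G} : rename.

Definition connected (G : sgraph) : bool :=
  [forall x : G, forall y : G, connect (@adj G) x y].

(* Length of a shortest walk from x to y; for x and y in different components,
   where no walk exists, the value is #|G|. *)
Definition dist (G : sgraph) (x y : G) : nat :=
  find (fun d => [exists p : d.-tuple G, path adj x p && (last x p == y)])
       (iota 0 #|G|).

Lemma dist_le (G : sgraph) (x : G) (p : seq G) :
  path adj x p -> dist x (last x p) <= size p.
Proof.
move=> xp; rewrite /dist; set a := fun d => _.
have ap : a (size p) by apply/existsP; exists (in_tuple p); rewrite xp eqxx.
have [pn|np] := ltnP (size p) #|G|; last first.
  by apply: leq_trans np; rewrite -{2}(size_iota 0 #|G|) find_size.
rewrite leqNgt; apply/negP => /(before_find 0).
by rewrite nth_iota // add0n ap.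
Qed.

Lemma dist_path (G : sgraph) (x y : G) :
  connect adj x y ->
  exists p : seq G, [/\ path adj x p, last x p = y & size p = dist x y].
Proof.
case/connectP=> p0 /shortenP[p xp up _] ->.
have szp : size p < #|G|.
  by have := max_card (mem (x :: p)); rewrite (card_uniqP up).
pose a d := [exists q : d.-tuple G, path adj x q && (last x q == last x p)].
have hasa : has a (iota 0 #|G|).
  apply/hasP; exists (size p); first by rewrite mem_iota.
  by apply/existsP; exists (in_tuple p); rewrite xp eqxx.
have lt := hasa; rewrite has_find size_iota in lt.
have := nth_find 0 hasa; rewrite nth_iota // add0n.
by case/existsP=> q /andP[xq /eqP lq]; exists q; split; rewrite ?size_tuple.
Qed.

Definition diameter (G : sgraph) : nat :=
  \max_(x : G) \max_(y : G) dist x y.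

(* dist is symmetric, so each unordered pair of distinct vertices is counted
   once, at its representative that is increasing for enum_rank. *)
Definition wiener (G : sgraph) : nat :=
  \sum_(p : G * G | enum_rank p.1 < enum_rank p.2) dist p.1 p.2.

Section DeleteVertex.
Variables (G : sgraph) (v : G).

Definition del_adj : rel {x : G | x != v} := fun x y => adj (val x) (val y).

Lemma del_adj_sym : symmetric del_adj.
Proof. by move=> x y; apply: adj_sym. Qed.

Lemma del_adj_irr : irreflexive del_adj.
Proof. by move=> x; apply: adj_irr. Qed.

Definition del_vertex : sgraph := SGraph del_adj_sym del_adj_irr.

Definition cut_vertex : bool := ~~ connected del_vertex.

End DeleteVertex.

Definition cutdiam_family (n k d : nat) (G : sgraph) : Prop :=
  [/\ connected G, #|G| = n, #|[set v : G | cut_vertex v]| = k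
    & diameter G = d].

(* The condition i != j only matters for n = 1. *)
Definition cycle_adj (n : nat) : rel 'I_n :=
  fun i j => (i != j) && ((j == ordS i) || (i == ordS j)).

Lemma cycle_adj_sym n : symmetric (@cycle_adj n).
Proof. by move=> i j; rewrite /cycle_adj eq_sym orbC. Qed.

Lemma cycle_adj_irr n : irreflexive (@cycle_adj n).
Proof. by move=> i; rewrite /cycle_adj eqxx. Qed.

Definition cycle_graph (n : nat) : sgraph :=
  SGraph (@cycle_adj_sym n) (@cycle_adj_irr n).

(* Main.v *)
(* Let n = 2m + 1, let x_1, ..., x_4 be the vertices that are not cut vertices,
   and call v a separator of x, y if every path from x to y meets v. Every
   component of G - v contains some x_i, so each vertex separates some pair of
   the x_i, and a pair has at most d(x_i, x_j) + 1 <= m + 1 separators. Two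
   disjoint pairs thus have at most n + 1 separators altogether, and counting
   shows that all vertices but at most one separate exactly one x_i from the
   other three, which makes them an arm ending at x_i. After appending the
   exceptional vertex to a shortest arm, G is partitioned into four arms of b_i
   vertices, of depths 0, ..., b_i - 1, such that vertices of depths s and t are
   at distance at most |s - t| within an arm and at most m - s - t in different
   arms. Hence b_i + b_j <= m + 1, so each b_i is m/2 rounded down or that plus
   one, and the resulting bound on W(G) is compared with W(C_n). *)

Require Import Defs.
From mathcomp Require Import all_boot ssralg zmodp zify.

Set Implicit Arguments.
Unset Strict Implicit.
Unset Printing Implicit Defensive.

(** * Separators and cut vertices *)

Section Distance.

Variable G : sgraph.
Hypothesis Gc : connected G.

Lemma connectG (x y : G) : connect adj x y.
Proof. by move/forallP/(_ x)/forallP/(_ y): Gc. Qed.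

Lemma distxx (x : G) : dist x x = 0.
Proof. by apply/eqP; rewrite -leqn0; apply: (@dist_le G x [::]). Qed.

Lemma dist_triangle (x y z : G) : dist x z <= dist x y + dist y z.
Proof.
have [p [xp <- <-]] := dist_path (connectG x y).
have [q [yq <- <-]] := dist_path (connectG (last x p) z).
by rewrite -size_cat -last_cat dist_le // cat_path xp.
Qed.

Lemma dist_sym (x y : G) : dist x y = dist y x.
Proof.
wlog suff: x y / dist x y <= dist y x.
  by move=> le; apply/eqP; rewrite eqn_leq !le.
have [p [yp lp <-]] := dist_path (connectG y x).
have xp : path adj x (rev (belast y p)).
  by rewrite -lp rev_path (eq_path (e' := adj)) // => u v; rewrite adj_sym.
have := dist_le xp; rewrite size_rev size_belast.
suff -> : last x (rev (belast y p)) = y by [].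
by case: p lp {yp xp} => [|z p] //=; rewrite rev_cons last_rcons.
Qed.

Lemma dist_eq0 (x y : G) : dist x y = 0 -> x = y.
Proof.
have [p [_ <- <-]] := dist_path (connectG x y).
by case: p.
Qed.

Lemma geodesic_point (x y : G) (s : nat) :
  s <= dist x y -> exists2 w, dist x w = s & dist x y = s + dist w y.
Proof.
have [p [xp lp sp]] := dist_path (connectG x y) => les.
exists (last x (take s p)).
all: have szp : size (take s p) = s by rewrite size_takel // sp.
all: move: xp lp; rewrite -{1 2}(cat_take_drop s p) cat_path last_cat.
all: move=> /andP[/dist_le xp1 /dist_le xp2] lp.
all: rewrite lp size_drop sp in xp2; rewrite szp in xp1.
all: have := dist_triangle x (last x (take s p)) y; lia.
Qed.

(** The edges of [G - v] as a relation on all of [G], so that deletions of different vertices can be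
    compared without subtypes. *)
Definition avoid (v : G) : rel G :=
  fun x y => [&& adj x y, x != v & y != v].

(* The class of v itself is {v}, so v separates itself from all others. *)
Definition linked (v : G) : rel G := connect (avoid v).

Lemma linkedxx v x : linked v x x. Proof. exact: connect0. Qed.

Lemma linked_sym v x y : linked v x y = linked v y x.
Proof.
by apply: sym_connect_sym => a b; rewrite /avoid /= adj_sym [(a != v) && _]andbC.
Qed.

Lemma linked_trans v x y z : linked v x y -> linked v y z -> linked v x z.
Proof. exact: connect_trans. Qed.

Lemma path_linked v x p :
  path adj x p -> v \notin x :: p -> linked v x (last x p).
Proof.
move=> xp vp; apply/connectP; exists p => //.
elim: p x xp vp => //= y p IHp x /andP[xy yp].
rewrite !inE !negb_or => /and3P[nvx nvy vp].
by rewrite {1}/avoid xy ![_ == v]eq_sym nvx nvy IHp //= inE negb_or nvy.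
Qed.

Lemma linked_self v y : linked v v y -> v = y.
Proof. by case/connectP=> -[|z p] //=; rewrite /avoid eqxx andbF. Qed.

(** A geodesic from [y] to [z] must meet [v], and splits there. *)
Lemma dist_separator v y z :
  ~~ linked v y z -> dist y z = dist y v + dist v z.
Proof.
move=> nl; have := dist_triangle y v z.
have [p [yp lp sp]] := dist_path (connectG y z).
case: (boolP (v \in y :: p)) => [|np]; last first.
  by rewrite -lp (path_linked yp np) in nl.
rewrite inE => /orP[/eqP->|]; first by rewrite distxx.
move: yp lp sp => + + + vp; case/splitPr: vp => p1 p2.
rewrite -cat_rcons cat_path last_cat size_cat last_rcons.
move=> /andP[/dist_le + /dist_le] => + + lp.
rewrite last_rcons lp; lia.
Qed.

Lemma geodesic_linked u y v :
  dist y v <= dist y u -> u != v -> linked u y v.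
Proof.
move=> le nuv; apply/negPn/negP => /dist_separator E.
by case/eqP: nuv; apply: dist_eq0; lia.
Qed.

(** The one of [v], [w] farther from [y] cannot separate [y] from the nearer one. *)
Lemma linkedVlinked v w y : v != w -> linked v y w || linked w y v.
Proof.
move=> nvw; have [le|le] := leqP (dist y w) (dist y v).
  by rewrite geodesic_linked.
by rewrite orbC geodesic_linked 1?eq_sym // ltnW.
Qed.

Lemma separators_dist u v y z :
  ~~ linked u y z -> ~~ linked v y z -> dist y u <= dist y v ->
  dist y v = dist y u + dist u v.
Proof.
move=> su sv le; have [<-|nuv] := eqVneq u v; first by rewrite distxx addn0.
(* Here [v] is no farther from [z] than [u] is, so [u] cannot cut [z] off from [v]; it must
   therefore separate [y] from [v]. *)
apply: dist_separator; apply: contra (su) => l; apply: linked_trans l _.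
rewrite linked_sym geodesic_linked //.
have := dist_separator su; have := dist_separator sv.
rewrite (dist_sym z) (dist_sym z u); lia.
Qed.

Lemma separators_inj u v y z :
  ~~ linked u y z -> ~~ linked v y z -> dist y u = dist y v -> u = v.
Proof.
move=> su sv e; apply: dist_eq0.
have := separators_dist su sv; rewrite e; lia.
Qed.

(** On separators of [y] and [z], the distance from [y] is injective with values at most
    [dist y z]. *)
Lemma card_separators y z :
  #|[set v | ~~ linked v y z]| <= (dist y z).+1.
Proof.
have ltd v : ~~ linked v y z -> dist y v < (dist y z).+1.
  by move/dist_separator->; rewrite ltnS leq_addr.
rewrite -[X in _ <= X]card_ord.
rewrite -(card_in_imset (f := fun v => inord (dist y v) : 'I_(dist y z).+1)).
  exact: max_card.
move=> u v; rewrite !inE => su sv /(congr1 val).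
by rewrite /= !inordK ?ltd //; exact: (separators_inj su sv).
Qed.

Lemma separators_full y z s :
  #|[set v : G | ~~ linked v y z]| = (dist y z).+1 -> s <= dist y z ->
  exists2 v, ~~ linked v y z & dist y v = s.
Proof.
move=> cS les.
pose f v : 'I_(dist y z).+1 := inord (dist y v).
have ltd v : ~~ linked v y z -> dist y v < (dist y z).+1.
  by move/dist_separator->; rewrite ltnS leq_addr.
have fE v : ~~ linked v y z -> f v = dist y v :> nat.
  by move=> sv; rewrite /f inordK ?ltd.
have fT : f @: [set v : G | ~~ linked v y z] = setT.
  apply/eqP; rewrite eqEcard subsetT cardsT card_ord card_in_imset ?cS ?leqnn //.
  move=> u v; rewrite !inE => su sv /(congr1 val).
  by rewrite /= !fE //; apply: separators_inj su sv.
have : inord s \in f @: [set v : G | ~~ linked v y z] by rewrite fT.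
case/imsetP=> v; rewrite inE => sv /(congr1 val).
by rewrite /= inordK // fE // => ->; exists v.
Qed.

(** * Cut vertices in terms of separation *)

Lemma linked_noncut v : ~~ cut_vertex v ->
  forall y z, y != v -> z != v -> linked v y z.
Proof.
rewrite negbK => /forallP c y z yv zv.
have /forallP/(_ (Sub z zv))/connectP[p] := c (Sub y yv).
elim: p y yv => [|t p IHp] y yv /=; first by move=> _ [->]; apply: linkedxx.
move=> /andP[yt tp] lp.
apply: (@linked_trans v y (val t)).
  by apply: connect1; rewrite /avoid /= yv (valP t) !andbT.
apply: (IHp _ (valP t)).
all: by have -> : Sub (val t) (valP t) = t by apply: val_inj.
Qed.

Lemma noncut_linked v :
  (forall y z, y != v -> z != v -> linked v y z) -> ~~ cut_vertex v.
Proof.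
move=> l; rewrite negbK; apply/forallP=> -[y yv]; apply/forallP=> -[z zv].
have /connectP[p yp ez] := l y z yv zv; subst z.
elim: p y yv yp zv => [|t p IHp] y yv /=.
  by move=> _ zv; rewrite (bool_irrelevance yv zv) connect0.
case/andP=> /and3P[yt _ tv] tp zv.
apply: connect_trans (IHp t tv tp zv).
by apply: connect1.
Qed.

(* A vertex of the component of y in G - v farthest from v is not a cut
   vertex. *)
Lemma exists_linked_noncut v y :
  y != v -> exists2 x, ~~ cut_vertex x & linked v y x.
Proof.
move=> yv; case: (arg_maxnP (dist v) (linkedxx v y)) => w yw wmax.
have nwv : w != v.
  by apply: contra yv => /eqP E; move: yw; rewrite E linked_sym => /linked_self->.
exists w => //; apply: noncut_linked.
suff lv a : a != w -> linked w a v.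
  by move=> a b /lv av /lv; rewrite linked_sym; apply: linked_trans.
(* Outside the component of [w] in [G - v], [linkedVlinked] applies; inside it, maximality puts [a]
   no farther from [v] than [w] is. *)
move=> aw; have [aw'|] := boolP (linked v a w); last first.
  by move=> n; have := @linkedVlinked v w a; rewrite (negPf n) eq_sym; apply.
rewrite linked_sym geodesic_linked 1?eq_sym //; apply: wmax.
by apply: linked_trans yw _; rewrite linked_sym.
Qed.

End Distance.

(** * Sums over arms of prescribed sizes *)

(** With truncated subtraction the summand is |i - j|; the induction adds a last row and a last
    column. *)
Lemma sum_distn p :
  3 * (\sum_(i < p) \sum_(j < p) ((i - j) + (j - i))) = p * (p.-1 * p.+1).
Proof.
elim: p => [|p IHp]; first by rewrite big_ord0.
have S : 2 * \sum_(i < p) (p - i) = p * p.+1.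
  elim: p {IHp} => [|p IHp]; first by rewrite big_ord0.
  by rewrite big_ord_recl subn0 mulnDr IHp; lia.
have E : \sum_(i < p) \sum_(j < p.+1) ((i - j) + (j - i)) =
    \sum_(i < p) \sum_(j < p) ((i - j) + (j - i)) + \sum_(i < p) (p - i).
  rewrite -big_split; apply: eq_bigr => i _; rewrite big_ord_recr /=.
  by have := ltn_ord i; lia.
have F : \sum_(j < p) ((p - j) + (j - p)) = \sum_(i < p) (p - i).
  by apply: eq_bigr => i _; have := ltn_ord i; lia.
rewrite big_ord_recr /= E big_ord_recr /= F.
rewrite subnn !mulnDr IHp.
move: (\sum_(i < p) (p - i)) S => s; clear.
by case: p => [|p] /=; nia.
Qed.

(* Six times the sum of |s - t| over s, t < p, and of m - s - t over s < p and
   t < q. *)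
Definition arm_sum p := 2 * (p * (p.-1 * p.+1)).
Definition cross_sum m p q := 6 * (p * q * m) - 3 * (p * q * (p.-1 + q.-1)).

(** The right side is six times the sum of distances over ordered pairs in the cycle on 2m + 1
    vertices. *)
Lemma arm_sums_le m p q r s :
  3 <= m -> p + q + r + s = m.*2.+1 -> 0 < p -> 0 < q -> 0 < r -> 0 < s ->
  p + q <= m.+1 -> p + r <= m.+1 -> p + s <= m.+1 ->
  q + r <= m.+1 -> q + s <= m.+1 -> r + s <= m.+1 ->
  arm_sum p + arm_sum q + arm_sum r + arm_sum s +
  2 * (cross_sum m p q + cross_sum m p r + cross_sum m p s +
       cross_sum m q r + cross_sum m q s + cross_sum m r s) <=
  6 * (m.*2.+1 * (m * m.+1)).
Proof.
move=> m3 S p0 q0 r0 s0 pq pr ps qr qs rs.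
pose h := m./2.
have [e em] : exists e : bool, m = e + h.*2.
  by exists (odd m); rewrite odd_double_half.
(* Complementary pairs add up to 2m + 1, so every pair sums to m or m + 1; adding the three pairs
   that contain x gives m - 1 <= 2x <= m + 2. *)
have near x y z t : x + y + z + t = m.*2.+1 -> x + y <= m.+1 -> x + z <= m.+1 ->
   x + t <= m.+1 -> y + z <= m.+1 -> y + t <= m.+1 -> z + t <= m.+1 ->
   x = h \/ x = h.+1.
  by case: e em; lia.
have [k hk] : exists k, h = k.+1 by case: (h) em => [|k]; [case: e; lia|exists k].
have k1 : ~~ e -> 0 < k by case: e em; lia.
have [Hp Hq Hr Hs] : [/\ p = h \/ p = h.+1, q = h \/ q = h.+1,
                         r = h \/ r = h.+1 & s = h \/ s = h.+1].
  split; [apply: (near p q r s)|apply: (near q p r s)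
         |apply: (near r p q s)|apply: (near s p q r)]; lia.
rewrite /arm_sum /cross_sum.
move: em k1; rewrite hk in Hp Hq Hr Hs *; move=> em k1.
clear -Hp Hq Hr Hs em S k1.
case: e em k1 => em k1;
case: Hp => ?; case: Hq => ?; case: Hr => ?; case: Hs => ?;
subst; try lia; rewrite /=.
all: try (move: (k1 isT); clear; case: k => // k _).
all: nia.
Qed.

(** A value k forces the k + 1 distinct values 0, ..., k, so k < |A|; counting then yields exactly
    the initial segment. *)
Lemma perm_iota_closed (T : finType) (A : {set T}) (f : T -> nat) :
  {in A &, injective f} ->
  (forall u s, u \in A -> s < f u -> exists2 v, v \in A & f v = s) ->
  perm_eq [seq f u | u <- enum A] (iota 0 #|A|).
Proof.
move=> injf closed; set s := map _ _.
have us : uniq s.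
  by rewrite map_inj_in_uniq ?enum_uniq // => u v; rewrite !mem_enum; apply: injf.
have sz : size s = #|A| by rewrite size_map -cardE.
have sub : {subset s <= iota 0 #|A|}.
  move=> k0 /mapP[u]; rewrite mem_enum => uA ->.
  rewrite mem_iota /= add0n -sz -(size_iota 0 (f u).+1) uniq_leq_size ?iota_uniq //.
  move=> k; rewrite mem_iota /= add0n ltnS leq_eqVlt => /orP[/eqP->|].
    by apply: map_f; rewrite mem_enum.
  case/(closed u k uA) => v vA <-.
  by apply: map_f; rewrite mem_enum.
have [|_ e] := uniq_min_size us sub; first by rewrite size_iota sz.
by apply: uniq_perm; rewrite ?iota_uniq // => x; rewrite e.
Qed.

(** * The four arms *)

Section Arms.

Variables (G : sgraph) (m : nat).
Hypothesis Gc : connected G.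
Hypothesis diam : forall x y : G, dist x y <= m.
Hypothesis cardG : #|G| = m.*2.+1.

Variable X : {set G}.
Hypothesis inX : forall v, (v \in X) = ~~ cut_vertex v.
Hypothesis cardX : #|X| = 4.

(** A member of [X] is separated from the others by itself. For a cut vertex, every component of
    [G - v] meets [X], so [X] cannot lie in a single one. *)
Lemma exists_separated v :
  exists x y, [/\ x \in X, y \in X & ~~ linked v x y].
Proof.
have [vX|] := boolP (v \in X).
  have /card_gt0P[y] : 0 < #|X :\ v| by have := cardsD1 v X; rewrite vX; lia.
  case/setD1P=> yv yX; exists v, y; split=> //.
  by apply: contra yv => /linked_self->.
rewrite inX negbK => cv.
have [|nX] := boolP [exists x in X, exists y in X, ~~ linked v x y].
  by case/exists_inP=> x xX /exists_inP[y yX nl]; exists x, y; split.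
suff: ~~ cut_vertex v by rewrite cv.
apply: noncut_linked => y z.
move=> /(exists_linked_noncut Gc)[a aX ya] /(exists_linked_noncut Gc)[b bX zb].
apply: linked_trans ya _; rewrite linked_sym; apply: linked_trans zb _.
rewrite linked_sym; apply/negPn/negP => nl; case/negP: nX.
by apply/exists_inP; exists a; rewrite ?inX //; apply/exists_inP; exists b;
  rewrite ?inX.
Qed.

(* v lies on the pendant arm ending at x: all other vertices of X are in one
   component of G - v. *)
Definition on_arm v x :=
  [forall y in X :\ x, forall z in X :\ x, linked v y z].

Lemma on_armP v x :
  reflect (forall y z, y \in X -> z \in X -> y != x -> z != x -> linked v y z)
          (on_arm v x).
Proof.
apply: (iffP forall_inP) => [H y z yX zX yx zx|H y].
  have /H/forall_inP : y \in X :\ x by rewrite in_setD1 yx.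
  by apply; rewrite in_setD1 zx.
case/setD1P=> yx yX; apply/forall_inP=> z /setD1P[zx zX].
exact: H.
Qed.

Lemma on_armN v x :
  ~~ on_arm v x -> exists y z,
    [/\ y \in X, z \in X, y != x, z != x & ~~ linked v y z].
Proof.
case/forall_inPn=> y /setD1P[yx yX] /forall_inPn[z /setD1P[zx zX] nl].
by exists y, z.
Qed.

Lemma on_arm_self x : x \in X -> on_arm x x.
Proof.
by rewrite inX => xX; apply/on_armP=> y z _ _; apply: linked_noncut.
Qed.

(** Otherwise all of [X] would be linked in [G - v], against [exists_separated]. *)
Lemma on_arm_separates v x y :
  on_arm v x -> x \in X -> y \in X -> y != x -> ~~ linked v x y.
Proof.
move=> /on_armP av xX yX yx; apply/negP => l.
have [z [t [zX tX]]] := exists_separated v; case/negP.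
have lx w : w \in X -> linked v x w.
  by move=> wX; have [->|wx] := eqVneq w x; rewrite ?linkedxx //;
     apply: linked_trans l _; apply: av.
by apply: linked_trans (lx t tX); rewrite linked_sym lx.
Qed.

Definition off_arms v := [forall x in X, ~~ on_arm v x].

(** A class with three members of [X] leaves out at most one [x], and [v] would be on the arm of
    [x]. *)
Lemma off_arms_class v t :
  off_arms v -> #|[set x in X | linked v x t]| <= 2.
Proof.
move/forall_inP=> ov; set I := [set x in _ | _].
rewrite leqNgt; apply/negP => I3.
have IX : I \subset X by apply/subsetP=> x; rewrite inE => /andP[].
have cD : #|X :\: I| <= 1 by rewrite cardsD (setIidPr IX); lia.
suff [x xX xI] : exists2 x, x \in X & X :\ x \subset I.
  case/negP: (ov x xX); apply/on_armP=> y z yX zX yx zx.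
  have := subsetP xI z; have := subsetP xI y.
  rewrite !inE yx zx yX zX /=.
  by move=> /(_ isT) yt /(_ isT); rewrite linked_sym; apply: linked_trans yt.
have [D0|[x xD]] := set_0Vmem (X :\: I).
  have /card_gt0P[x xX] : 0 < #|X| by rewrite cardX.
  exists x => //; apply: subset_trans (subsetDl _ _) _.
  by rewrite -setD_eq0 D0.
exists x; first by case/setDP: xD.
apply/subsetP=> y /setD1P[yx yX]; apply/negPn/negP => yI.
have : [set x; y] \subset X :\: I.
  by apply/subsetP=> z /set2P[]->; rewrite // inE yI.
by move/subset_leq_card; rewrite cards2 eq_sym yx; lia.
Qed.

(* Geodesics a - c and b - d have at most n + 1 vertices in all, so separators
   of both pairs are rare when every vertex separates at least one of them. *)
Lemma double_separators a b c d :
  (forall v, ~~ linked v a c || ~~ linked v b d) ->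
  #|[set v : G | ~~ linked v a c] :&: [set v : G | ~~ linked v b d]| <= 1 /\
  (0 < #|[set v : G | ~~ linked v a c] :&: [set v : G | ~~ linked v b d]| ->
   dist a c = m /\ #|[set v : G | ~~ linked v a c]| = m.+1).
Proof.
set A := [set _ | _]; set B := [set v : G | ~~ linked v b d] => H.
have AB : A :|: B = setT by apply/setP=> v; rewrite !inE H.
have := cardsUI A B; rewrite AB cardsT cardG.
have := card_separators Gc a c; have := card_separators Gc b d.
rewrite -/A -/B; have := diam a c; have := diam b d; lia.
Qed.

Lemma on_armVoff v : (exists2 x, x \in X & on_arm v x) \/ off_arms v.
Proof.
have [/exists_inP[x xX av]|] := boolP [exists x in X, on_arm v x].
  by left; exists x.
by move=> n; right; rewrite /off_arms -negb_exists_in.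
Qed.

(** Two such vertices would both split [X] into the same classes {a, b} and {c, d}. Both would then
    separate a from c and b from d, while [double_separators] allows only one vertex to do so. *)
Lemma off_arms_unique v w : off_arms v -> off_arms w -> v = w.
Proof.
move=> ov ow; apply/eqP; apply: contraT => vw.
have := off_arms_class w ov; have := off_arms_class v ow.
set I := [set x in _ | linked v x w]; set J := [set x in _ | _].
move=> leJ leI; have XIJ : X = I :|: J.
  by apply/setP=> x; rewrite !inE -andb_orr linkedVlinked // andbT.
have := cardsUI I J; rewrite -XIJ cardX => cIJ.
have [/eqP/cards2P[a [b [ab eI]]] /eqP/cards2P[c [d [cd eJ]]] /eqP] :
    [/\ #|I| = 2, #|J| = 2 & #|I :&: J| = 0].
  by move: leI leJ cIJ; clear; split; lia.
rewrite cards_eq0 => /eqP IJ.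
have [IX JX] : I \subset X /\ J \subset X by rewrite XIJ subsetUl subsetUr.
have sep x y : x \in I -> y \in J -> ~~ linked v x y /\ ~~ linked w x y.
  move=> xI yJ; split; apply/negP => l.
    suff: y \in I :&: J by rewrite IJ inE.
    rewrite inE yJ andbT inE (subsetP JX) //.
    by move: xI; rewrite inE => /andP[_]; apply: linked_trans; rewrite linked_sym.
  suff: x \in I :&: J by rewrite IJ inE.
  rewrite inE xI inE (subsetP IX) //.
  by move: yJ; rewrite inE => /andP[_]; apply: linked_trans.
have [aI bI cJ dJ] : [/\ a \in I, b \in I, c \in J & d \in J].
  by rewrite eI eJ !inE !eqxx !orbT.
have neq x y : x \in I -> y \in J -> y != x.
  by move=> xI /(sep _ _ xI)[+ _]; apply: contra => /eqP->; apply: linkedxx.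
have aX := subsetP IX a aI; have bX := subsetP IX b bI.
have cX := subsetP JX c cJ; have dX := subsetP JX d dJ.
have sep_ac_bd u : ~~ linked u a c || ~~ linked u b d.
  have [[x xX au]|ou] := on_armVoff u.
    have ax y : y \in X -> y != x -> ~~ linked u x y.
      by apply: on_arm_separates.
    move: xX; rewrite XIJ eI eJ => /setUP[]/set2P[] xE; move: ax; rewrite xE.
    - by move=> ->; rewrite ?neq.
    - by move=> ->; rewrite ?neq ?orbT.
    - by rewrite ![linked u _ c]linked_sym => ->; rewrite // eq_sym neq.
    - by rewrite ![linked u _ d]linked_sym => ->; rewrite ?orbT // eq_sym neq.
  have [->|uv] := eqVneq u v; first by have [->] := sep a c aI cJ.
  rewrite -negb_and; apply/negP => /andP[ac bd].
  (* If [u] cut [x] and [y] off from [v], both would be linked to [u] in [G - v], although [v]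
     separates them. *)
  have both x y : x \in I -> y \in J -> linked u x y -> linked u x v /\ linked u y v.
    move=> xI yJ xy; have [xv|xv] := boolP (linked u x v).
      by split=> //; apply: linked_trans xv; rewrite linked_sym.
    have yv : ~~ linked u y v by apply: contra xv; apply: linked_trans.
    have := linkedVlinked Gc x uv; have := linkedVlinked Gc y uv.
    rewrite (negPf xv) (negPf yv) /= => yu xu; have [/negP[]] := sep x y xI yJ.
    by apply: linked_trans xu _; rewrite linked_sym.
  have [av cv] := both a c aI cJ ac; have [bv dv] := both b d bI dJ bd.
  have := off_arms_class v ou; suff -> : [set x in X | linked u x v] = X.
    by rewrite cardX.
  apply/setP=> x; rewrite inE andb_idr // XIJ eI eJ.
  by case/setUP=> /set2P[]->.
have [le1 _] := double_separators sep_ac_bd.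
suff /subset_leq_card : [set v; w] \subset
    [set u : G | ~~ linked u a c] :&: [set u : G | ~~ linked u b d].
  by rewrite cards2 vw => /leq_trans/(_ le1).
apply/subsetP=> u /set2P[]->; rewrite !inE.
  by have [-> _] := sep a c aI cJ; have [-> _] := sep b d bI dJ.
by have [_ ->] := sep a c aI cJ; have [_ ->] := sep b d bI dJ.
Qed.

(* A vertex off the arms splits X into classes of size at most 2, so X can be
   matched into pairs that it separates. *)
Lemma off_arms_pairing c k : off_arms c -> k \in X -> exists l p q,
  [/\ X = [set k; l] :|: [set p; q], uniq [:: k; l; p; q],
      ~~ linked c k l & ~~ linked c p q].
Proof.
move=> oc kX; have /on_armN[y [z [yX zX yk zk yz]]] := forall_inP oc k kX.
have neyz : y != z by apply: contra yz => /eqP->; apply: linkedxx.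
have /eqP/cards1P[t /setP et] : #|X :\ k :\ y :\ z| = 1.
  have := cardsD1 k X; have := cardsD1 y (X :\ k).
  have := cardsD1 z (X :\ k :\ y).
  by rewrite kX cardX !inE yX zX yk zk eq_sym neyz; clear; lia.
have := et t; rewrite !inE eqxx => /and4P[tz ty tk tX].
have eX : X = [set k; t] :|: [set y; z].
  apply/setP=> u; have := et u; rewrite !inE.
  have [->|uz] := eqVneq u z; first by rewrite zX !orbT.
  have [->|uy] := eqVneq u y; first by rewrite yX !orbT.
  have [->|uk] := eqVneq u k; first by rewrite kX.
  by rewrite /= !orbF.
(* With [t] the fourth member, the pairs are {k, t}, {y, z} if [c] separates [k] from [t]; otherwise
   the class of [k] is {k, t} and the pairs are {k, y}, {z, t}. *)
have [kt|kt] := boolP (linked c k t); last first.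
  exists t, y, z; split=> //; rewrite /= !inE !negb_or ![k == _]eq_sym.
  by rewrite tk yk zk ty tz neyz.
have class3 u : u \in X -> u != k -> u != t -> ~~ linked c k u.
  move=> uX uk ut; apply/negP => ku; have := off_arms_class k oc.
  suff: [set u; t; k] \subset [set x in X | linked c x k].
    move/subset_leq_card; rewrite -setUA !cardsU1 !inE cards1 negb_or.
    by rewrite (negPf ut) uk tk => /leq_trans H /H.
  apply/subsetP=> x; rewrite !inE => /orP[/orP[]|] /eqP->.
  - by rewrite uX linked_sym.
  - by rewrite tX linked_sym.
  - by rewrite kX linkedxx.
exists y, z, t; split=> //.
- by rewrite eX; apply/setP=> u; rewrite !inE;
    case: (u == k); case: (u == t); case: (u == y); case: (u == z).
- rewrite /= !inE !negb_or ![k == _]eq_sym [y == t]eq_sym [z == t]eq_sym.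
  by rewrite tk yk zk ty tz neyz.
- by rewrite class3 // eq_sym.
- have := class3 z zX zk; rewrite eq_sym tz => /(_ isT); apply: contra.
  by rewrite linked_sym; apply: linked_trans.
Qed.

(** Every vertex separates one of the two pairs and [c] separates both, so [double_separators] is
    tight: the pair [k], [l] has distance m and a separator at each distance from [k]. *)
Lemma off_arms_partner c k : off_arms c -> k \in X -> exists l,
  [/\ l \in X, l != k, ~~ linked c k l, dist k l = m &
      forall s, s <= m -> exists2 v, ~~ linked v k l & dist k v = s].
Proof.
move=> oc kX; have [l [p [q [eX + ckl cpq]]]] := off_arms_pairing oc kX.
rewrite /= !inE !negb_or => /and4P[/and3P[kl kp kq] /andP[lp lq] pq _].
have sep v : ~~ linked v k l || ~~ linked v p q.
  have [[x xX av]|ov] := on_armVoff v; last by rewrite (off_arms_unique ov oc) ckl.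
  have ax y : y \in X -> y != x -> ~~ linked v x y by apply: on_arm_separates.
  move: ax; have := xX; rewrite {1 2}eX => /setUP[]/set2P[]->.
  - by move=> ->; rewrite // ?inE ?eqxx ?orbT // eq_sym.
  - by rewrite [linked v k l]linked_sym => ->; rewrite // !inE ?eqxx ?orbT.
  - by move=> ->; rewrite ?orbT // ?inE ?eqxx ?orbT // eq_sym.
  - by rewrite [linked v p q]linked_sym => ->; rewrite ?orbT // !inE ?eqxx ?orbT.
have [_ []] := double_separators sep.
  by apply/card_gt0P; exists c; rewrite !inE ckl cpq.
move=> dkl cS; exists l; split=> //; rewrite ?[l == k]eq_sym //.
  by rewrite eX !inE eqxx orbT.
by move=> s sm; apply: (separators_full Gc); rewrite dkl.
Qed.

Lemma on_arm_unique v x y :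
  x \in X -> y \in X -> on_arm v x -> on_arm v y -> x = y.
Proof.
move=> xX yX ax ay; apply/eqP; apply: contraT => xy.
have /card_gt0P[z] : 0 < #|X :\ x :\ y|.
  have := cardsD1 x X; have := cardsD1 y (X :\ x).
  by rewrite cardX xX !inE yX eq_sym xy; lia.
rewrite !inE => /and3P[zy zx zX].
by have /negP[] := on_arm_separates ax xX zX zx; apply: (on_armP _ _ ay).
Qed.

(* Every other branching vertex lies beyond the arm: otherwise a geodesic of
   the pair separated by c could be shortened at v. *)
Lemma on_arm_dist v c j :
  j \in X -> on_arm v j -> ~~ on_arm c j -> dist j v <= dist j c.
Proof.
move=> jX av /on_armN[a [b [aX bX aj bj]]].
have va := dist_separator Gc (on_arm_separates av jX aX aj).
have vb := dist_separator Gc (on_arm_separates av jX bX bj).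
(* As [c] separates [a] from [b], it separates [j] from one of them, here called [b]. *)
wlog cb : a b aX bX aj bj va vb / ~~ linked c j b => [H|].
  move=> cab; have [cb|cb] := boolP (linked c j b); last exact: (H a b).
  apply: (H b a) => //; last by rewrite linked_sym.
  by apply: contra cab; rewrite linked_sym => /linked_trans/(_ cb).
move/(dist_separator Gc); have := dist_separator Gc cb.
have := dist_triangle Gc a v b; have := dist_triangle Gc j c a.
rewrite (dist_sym Gc a v) (dist_sym Gc c a); clear -va vb; lia.
Qed.

(* The at most one vertex off the arms is appended to a shortest arm. *)
Definition arm v :=
  odflt v [pick x in X | on_arm v x ||
                         off_arms v && [forall y in X, dist x v <= dist y v]].

(** The [pick] succeeds: a vertex off the arms has a nearest member of [X]. *)
Lemma armP v : arm v \in X /\ (on_arm v (arm v) \/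
  off_arms v /\ forall y, y \in X -> dist (arm v) v <= dist y v).
Proof.
rewrite /arm; case: pickP => [x /andP[xX /orP[ax|/andP[ov /forall_inP le]]]|n] /=.
- by split=> //; left.
- by split=> //; right.
have [[x xX ax]|ov] := on_armVoff v; first by have := n x; rewrite /= xX ax.
have /card_gt0P[x0 x0X] : 0 < #|X| by rewrite cardX.
case: (@arg_minnP _ x0 (fun x => x \in X) (fun x : G => dist x v) x0X) => x xX xmin.
have := n x; rewrite /= xX ov /=.
by have -> : [forall y in X, dist x v <= dist y v]; [apply/forall_inP|rewrite orbT].
Qed.

Lemma arm_in v : arm v \in X. Proof. by have [] := armP v. Qed.

Lemma arm_on v x : x \in X -> on_arm v x -> arm v = x.
Proof.
move=> xX ax; have [aX [av|[/forall_inP/(_ x xX)]]] := armP v.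
  exact: on_arm_unique av ax.
by rewrite ax.
Qed.

(** * Depth along an arm, and distances in terms of it *)

Definition depth v := dist (arm v) v.

(** Two separators of one pair are as far apart as their depths differ. For a vertex off the arms
    [l] is the partner of the arm's end; otherwise any other member of [X] serves. *)
Lemma arm_common_separated u v : arm u = arm v ->
  exists l, ~~ linked u (arm u) l /\ ~~ linked v (arm u) l.
Proof.
wlog off : u v / on_arm v (arm v) => [H|] uv.
  have [_ [av|[ov _]]] := armP v; first exact: H.
  have [_ [au|[ou _]]] := armP u.
    by have [l [? ?]] := H v u au (esym uv); exists l; rewrite uv.
  rewrite (off_arms_unique ou ov).
  by have [l [_ _ sl _ _]] := off_arms_partner ov (arm_in v); exists l.
have [_ [au|[ou _]]] := armP u; last first.
  have [l [lX lk sl _ _]] := off_arms_partner ou (arm_in u); exists l; split=> //.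
  by rewrite uv in lk *; apply: on_arm_separates; rewrite ?arm_in.
have /card_gt0P[l] : 0 < #|X :\ arm u|.
  by have := cardsD1 (arm u) X; rewrite arm_in; lia.
case/setD1P=> lu lX; exists l; split; first exact: on_arm_separates (arm_in u) lX lu.
by rewrite uv in lu *; apply: on_arm_separates; rewrite ?arm_in.
Qed.

Lemma dist_same_arm u v : arm u = arm v ->
  dist u v <= (depth u - depth v) + (depth v - depth u).
Proof.
rewrite /depth => uv; have [l [su sv]] := arm_common_separated uv; rewrite -uv.
have [le|lt] := leqP (dist (arm u) u) (dist (arm u) v).
  have := separators_dist Gc su sv le; lia.
have := separators_dist Gc sv su (ltnW lt); rewrite (dist_sym Gc v); lia.
Qed.

Lemma depth_inj u v : arm u = arm v -> depth u = depth v -> u = v.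
Proof.
move=> /dist_same_arm le e; apply: (dist_eq0 Gc); lia.
Qed.

Lemma depth_closed u s : s < depth u -> exists2 v, arm v = arm u & depth v = s.
Proof.
rewrite /depth => su; have [xX [au|[ou _]]] := armP u.
  have [w ws sw] := geodesic_point Gc (ltnW su).
  have nuw : u != w by apply: contraTneq su => e; rewrite -ws -e ltnn.
  suff /(arm_on xX) aw : on_arm w (arm u) by exists w; rewrite aw.
  have xw : linked u (arm u) w.
    by apply: geodesic_linked => //; rewrite ws ltnW.
  (* The point [w] stays on the end's side of [u], so [u] separates it from the rest of [X], which
     is therefore linked to [u] in [G - w]. *)
  have lw y : y \in X -> y != arm u -> linked w y u.
    move=> yX yx; have := linkedVlinked Gc y nuw.
    suff /negPf-> : ~~ linked u y w by [].
    apply: contra (on_arm_separates au xX yX yx) => yw.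
    by apply: linked_trans xw _; rewrite linked_sym.
  apply/on_armP=> y z yX zX yx zx.
  by apply: linked_trans (lw y yX yx) _; rewrite linked_sym lw.
have [l [lX lk ckl dkl full]] := off_arms_partner ou xX.
have [|v sv vs] := full s; first by apply: leq_trans (ltnW su) (diam _ _).
suff av : on_arm v (arm u) by exists v; rewrite (arm_on xX av).
have [[y yX av]|ov] := on_armVoff v; last first.
  by move: su; rewrite -vs (off_arms_unique ov ou) ltnn.
have [<- //|ky] := eqVneq y (arm u).
(* On a third arm, [v] would not separate [arm u] from [l]. On the arm of [l], it would be no
   farther from [l] than [u], hence at depth at least that of [u]. *)
have [yl|ly] := eqVneq y l; last first.
  by case/negP: sv; apply: (on_armP _ _ av); rewrite // eq_sym.
rewrite yl in av; have := on_arm_dist lX av (forall_inP ou l lX).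
have := dist_separator Gc sv; have := dist_separator Gc ckl.
rewrite (dist_sym Gc l) (dist_sym Gc l u); clear -su vs; lia.
Qed.

(** If both are on arms, they lie in order between the two ends, which are at distance at most m. If
    [u] is off the arms, they lie between [arm v] and its partner [l] at distance m, and [arm u] is
    no farther from [u] than [l] is. *)
Lemma dist_diff_arm u v : arm u != arm v -> dist u v + depth u + depth v <= m.
Proof.
rewrite /depth.
wlog av : u v / on_arm v (arm v) => [H|] uv.
  have [_ [av|[ov _]]] := armP v; first exact: H.
  have [_ [au|[ou _]]] := armP u; last by rewrite (off_arms_unique ou ov) eqxx in uv.
  by rewrite dist_sym // addnAC; apply: H; rewrite // eq_sym.
have [jX iX] := (arm_in v, arm_in u).
have [_ [au|[ou umin]]] := armP u.
  have nuj : ~~ on_arm u (arm v).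
    by apply: contra uv => auj; apply/eqP; apply: on_arm_unique au auj.
  have le := on_arm_dist jX av nuj.
  have su := on_arm_separates au iX jX; rewrite eq_sym in su.
  have sv := on_arm_separates av jX iX uv; rewrite linked_sym in sv.
  have {}su := su uv.
  have := dist_separator Gc su; have := dist_separator Gc sv.
  have := separators_dist Gc su sv; have := diam (arm u) (arm v).
  rewrite (dist_sym Gc v) (dist_sym Gc u (arm v)); clear -le; lia.
have [l [lX lj sl djl _]] := off_arms_partner ou jX.
have le := on_arm_dist jX av (forall_inP ou _ jX).
have sv := on_arm_separates av jX lX lj.
have := separators_dist Gc sv sl le; have := dist_separator Gc sl.
have := umin l lX; rewrite (dist_sym Gc l) (dist_sym Gc v u); clear -djl; lia.
Qed.

(** * Sizes of the arms and distance sums over them *)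

Definition arm_set x := [set u : G | arm u == x].

Lemma arm_setP u x : reflect (arm u = x) (u \in arm_set x).
Proof. by rewrite inE; apply: eqP. Qed.

Lemma perm_depth x :
  perm_eq [seq depth u | u <- enum (arm_set x)] (iota 0 #|arm_set x|).
Proof.
apply: perm_iota_closed => [u v /arm_setP ux /arm_setP vx|u s /arm_setP <- su].
  by apply: depth_inj; rewrite ux vx.
have [v vu vs] := depth_closed su.
by exists v => //; apply/arm_setP.
Qed.

Lemma sum_arm x (F : nat -> nat) :
  \sum_(u in arm_set x) F (depth u) = \sum_(s < #|arm_set x|) F s.
Proof.
rewrite -(big_mkord xpredT) /index_iota subn0 -(perm_big _ (perm_depth x)) /=.
by rewrite big_map big_enum.
Qed.

Lemma arm_set_gt0 x : x \in X -> 0 < #|arm_set x|.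
Proof.
move=> xX; apply/card_gt0P; exists x; apply/arm_setP.
exact: (arm_on xX (on_arm_self xX)).
Qed.

Lemma arm_top x : x \in X -> exists2 u, arm u = x & (depth u).+1 = #|arm_set x|.
Proof.
move=> xX; have x0 := arm_set_gt0 xX.
have : #|arm_set x|.-1 \in iota 0 #|arm_set x|.
  by rewrite mem_iota /= add0n prednK.
rewrite -(perm_mem (perm_depth x)) => /mapP[u].
by rewrite mem_enum => /arm_setP ux du; exists u; rewrite // -du prednK.
Qed.

(** The deepest vertices of the arms have depths one less than the arm sizes, and are at distance at
    least 1. *)
Lemma card_two_arms x y :
  x \in X -> y \in X -> x != y -> #|arm_set x| + #|arm_set y| <= m.+1.
Proof.
move=> /arm_top[u <- <-] /arm_top[v <- <-] uv.
have := dist_diff_arm uv.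
suff : 0 < dist u v by lia.
rewrite lt0n; apply: contra uv => /eqP/(dist_eq0 Gc)->; exact: eqxx.
Qed.

Lemma sum_same_arm x :
  6 * (\sum_(u in arm_set x) \sum_(v in arm_set x) dist u v) <=
  arm_sum #|arm_set x|.
Proof.
rewrite /arm_sum -sum_distn mulnA leq_pmul2l //.
rewrite -(sum_arm x (fun i => \sum_(j < _) ((i - j) + (j - i)))).
apply: leq_sum => u /arm_setP ux.
rewrite -(sum_arm x (fun j => (depth u - j) + (j - depth u))).
apply: leq_sum => v /arm_setP vx.
by apply: dist_same_arm; rewrite ux vx.
Qed.

Lemma sum_depth x :
  2 * (\sum_(u in arm_set x) depth u) = #|arm_set x| * #|arm_set x|.-1.
Proof.
rewrite (sum_arm x id) -(big_mkord xpredT id) /= bin2_sum.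
by rewrite bin2 mul2n even_halfK //; case: #|_| => //= n; rewrite oddM /= andNb.
Qed.

Lemma sum_diff_arm x y : x != y ->
  6 * (\sum_(u in arm_set x) \sum_(v in arm_set y) dist u v) <=
  cross_sum m #|arm_set x| #|arm_set y|.
Proof.
move=> xy; set D := \sum_(u in _) _; set p := #|_|; set q := #|arm_set y|.
(* Depths are added on the left, which avoids truncated subtraction termwise. *)
have le : \sum_(u in arm_set x) \sum_(v in arm_set y)
    (dist u v + depth u + depth v) <= p * (q * m).
  rewrite /p /q -!sum_nat_const; apply: leq_sum => u /arm_setP ux.
  apply: leq_sum => v /arm_setP vy.
  by apply: dist_diff_arm; rewrite ux vy.
have E : \sum_(u in arm_set x) \sum_(v in arm_set y)
    (dist u v + depth u + depth v) =
    D + q * (\sum_(u in arm_set x) depth u) + p * \sum_(v in arm_set y) depth v.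
  rewrite big_distrr /= -sum_nat_const -!big_split /=; apply: eq_bigr => u _.
  by rewrite !big_split /= sum_nat_const.
have := sum_depth x; have := sum_depth y; rewrite -/p -/q.
move: le; rewrite {}E /cross_sum.
move: D p q (\sum_(u in arm_set x) _) (\sum_(u in arm_set y) _) => D p q a b.
by clear; nia.
Qed.

Lemma sum_over_arms (F : G -> nat) :
  \sum_u F u = \sum_(x in X) \sum_(u in arm_set x) F u.
Proof.
rewrite (partition_big arm (mem X)) => [|u _]; last by apply: arm_in.
by apply: eq_bigr => x _; apply: eq_bigl => u; rewrite inE.
Qed.

Hypothesis m_ge3 : 3 <= m.

Lemma sum_dist_le :
  \sum_(u : G) \sum_(v : G) dist u v <= m.*2.+1 * (m * m.+1).
Proof.
rewrite -(leq_pmul2l (isT : 0 < 6)).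
pose D x y := \sum_(u in arm_set x) \sum_(v in arm_set y) dist u v.
have -> : \sum_(u : G) \sum_(v : G) dist u v = \sum_(x in X) \sum_(y in X) D x y.
  rewrite sum_over_arms; apply: eq_bigr => x _.
  by rewrite exchange_big sum_over_arms; apply: eq_bigr => y _; rewrite exchange_big.
have sumb : \sum_(x in X) #|arm_set x| = m.*2.+1.
  rewrite -cardG -sum1_card sum_over_arms.
  by apply: eq_bigr => x _; rewrite sum1_card.
have same x : 6 * D x x <= arm_sum #|arm_set x| by apply: sum_same_arm.
have diff x y : x != y ->
    6 * (D x y + D y x) <= 2 * cross_sum m #|arm_set x| #|arm_set y|.
  move=> xy; rewrite mulnDr mul2n -addnn leq_add ?sum_diff_arm //.
  rewrite /cross_sum [_ * #|arm_set y|]mulnC [_ + _.-1]addnC.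
  by rewrite sum_diff_arm // eq_sym.
have eX F : \sum_(x in X) F x = \sum_(x <- enum X) F x by rewrite big_enum.
have uX := enum_uniq (mem X).
have memX x : x \in enum X -> x \in X by rewrite mem_enum.
have := cardE (mem X); rewrite cardX.
under eq_bigr => x _ do rewrite eX.
(* Listing the four members of [X] gives sixteen blocks: four diagonal ones and six symmetric
   pairs. *)
move: sumb; rewrite !eX; case: (enum X) uX memX => [|a [|b [|c [|d []]]]] //.
rewrite /= !inE !negb_or => /and4P[/and3P[ab ac ad] /andP[bc bd] cd _] memX.
rewrite !big_cons !big_nil !addn0 => sumb _.
have [aX bX cX dX] : [/\ a \in X, b \in X, c \in X & d \in X].
  by rewrite !memX ?inE ?eqxx ?orbT.
apply: leq_trans (arm_sums_le m_ge3 _ (arm_set_gt0 aX) (arm_set_gt0 bX)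
  (arm_set_gt0 cX) (arm_set_gt0 dX) (card_two_arms aX bX ab)
  (card_two_arms aX cX ac) (card_two_arms aX dX ad) (card_two_arms bX cX bc)
  (card_two_arms bX dX bd) (card_two_arms cX dX cd)); last by rewrite -sumb !addnA.
move: (same a) (same b) (same c) (same d) (diff a b ab) (diff a c ac).
move: (diff a d ad) (diff b c bc) (diff b d bd) (diff c d cd).
rewrite !mulnDr; clear; lia.
Qed.

End Arms.

(** * Comparison with the cycle *)

Lemma wiener_double (G : sgraph) : connected G ->
  \sum_(u : G) \sum_(v : G) dist u v = (wiener G).*2.
Proof.
move=> Gc; rewrite pair_big /= (bigID (fun p => enum_rank p.1 < enum_rank p.2)) /=.
rewrite -addnn; congr (_ + _).
rewrite (bigID (fun p => p.1 == p.2)) /= big1 ?add0n; last first.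
  by move=> p /andP[_ /eqP->]; apply: distxx.
rewrite (reindex_inj (h := fun p : G * G => (p.2, p.1))) /=; last first.
  by move=> [a b] [c d] /= [-> ->].
apply: eq_big => [p|p _]; last exact: dist_sym.
rewrite -leqNgt ltn_neqAle andbC; congr (_ && _).
by rewrite eq_sym -(inj_eq enum_rank_inj).
Qed.

(** The length of the shorter arc between positions i and j on the cycle. *)
Definition cyc_dist n i j := minn ((i - j) + (j - i)) (n - ((i - j) + (j - i))).

(** One step changes the shorter arc by at most one, also across the wraparound from n - 1 to 0. *)
Lemma cycle_path n (i : 'I_n) (p : seq 'I_n) :
  path (@cycle_adj n) i p -> cyc_dist n i (last i p) <= size p.
Proof.
elim: p i => [|k p IHp] i /=; first by rewrite /cyc_dist subnn min0n.
case/andP=> /andP[_ adj] /IHp; set j := last k p.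
have [ki|ki] : k = i.+1 %% n :> nat \/ i = k.+1 %% n :> nat.
  by case/orP: adj => /eqP->; [left|right].
- have [i1|i1] := ltnP i.+1 n.
    by rewrite modn_small in ki; rewrite /cyc_dist; lia.
  have e : i.+1 = n by apply/eqP; rewrite eqn_leq i1 ltn_ord.
  rewrite e modnn in ki; rewrite /cyc_dist; have := ltn_ord j; lia.
- have [i1|i1] := ltnP k.+1 n.
    by rewrite modn_small in ki; rewrite /cyc_dist; lia.
  have e : k.+1 = n by apply/eqP; rewrite eqn_leq i1 ltn_ord.
  rewrite e modnn in ki; rewrite /cyc_dist; have := ltn_ord j; lia.
Qed.

Lemma cycle_connected n : connected (cycle_graph n).
Proof.
case: n => [|n]; first by apply/forallP=> -[].
have c0 k (kn : k < n.+1) : connect (@cycle_adj n.+1) ord0 (Ordinal kn).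
  elim: k kn => [|k IHk] kn.
    by rewrite (_ : Ordinal kn = ord0) ?connect0 //; apply: val_inj.
  apply: connect_trans (IHk (ltnW kn)) _; apply: connect1.
  rewrite /cycle_adj; apply/andP; split; first by rewrite -val_eqE /=; lia.
  by apply/orP; left; apply/eqP/val_inj; rewrite /= modn_small.
apply/forallP=> -[i ip]; apply/forallP=> -[j jp].
apply: connect_trans (c0 j jp).
by rewrite (sym_connect_sym (@cycle_adj_sym _)).
Qed.

Lemma cyc_dist_le n (i j : cycle_graph n) : cyc_dist n i j <= dist i j.
Proof.
have [p [ip <- <-]] := dist_path (connectG (@cycle_connected n) i j).
exact: cycle_path.
Qed.

Lemma sum_cyc_dist m (i : 'I_m.*2.+1) :
  \sum_(j < m.*2.+1) cyc_dist m.*2.+1 i j = m * m.+1.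
Proof.
(* Rotation by [i] in the integers mod 2m + 1 moves the base point to 0. *)
rewrite (reindex_inj (GRing.addrI i)) /=.
rewrite (eq_bigr (fun t : 'I_ _ => minn t (m.*2.+1 - t))) => [|t _]; last first.
  have := ltn_ord i; have := ltn_ord t => ti ii /=.
  have [lt|ge] := ltnP (i + t) m.*2.+1.
    by rewrite modn_small // /cyc_dist; lia.
  have e : i + t = 1 * m.*2.+1 + (i + t - m.*2.+1) by lia.
  rewrite e modnMDl modn_small; last by lia.
  by rewrite /cyc_dist; lia.
rewrite -(big_mkord xpredT (fun t => minn t (m.*2.+1 - t))).
(* For m + 1, the first term is 0 and the last is 1; the others, shifted, exceed those for m by one
   each. *)
elim: m {i} => [|m IHm]; first by rewrite big_nat1.
rewrite doubleS big_nat_recl // min0n add0n big_nat_recr //=.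
rewrite (eq_big_nat _ _ (F2 := fun t => 1 + minn t (m.*2.+1 - t))).
  by rewrite big_split /= IHm sum_nat_const_nat; lia.
by move=> t; lia.
Qed.

Theorem theorem5p8 (n : nat) (G : sgraph) :
  7 <= n -> odd n ->
  cutdiam_family n (n - 4) ((n - 1) %/ 2) G ->
  wiener G <= wiener (cycle_graph n).
Proof.
move=> n7 n_odd [Gc cardG cardcut diamG].
have [m nE] : exists m, n = m.*2.+1.
  by exists n./2; rewrite -{1}(odd_double_half n) n_odd.
rewrite nE in n7 cardG cardcut diamG *.
have {}diamG : diameter G = m by rewrite diamG; lia.
have diam (x y : G) : dist x y <= m.
  rewrite -diamG; apply: leq_trans (leq_bigmax x); exact: (leq_bigmax y).
pose X := ~: [set v : G | cut_vertex v].
have inX v : (v \in X) = ~~ cut_vertex v by rewrite !inE.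
have cardX : #|X| = 4.
  by have := cardsC [set v : G | cut_vertex v]; rewrite -/X cardcut cardG; lia.
have m3 : 3 <= m by lia.
(* Doubling passes to sums over ordered pairs; each vertex of the cycle then contributes at least
   m(m + 1). *)
rewrite -leq_double -!wiener_double ?cycle_connected //.
apply: leq_trans (sum_dist_le Gc diam cardG inX cardX m3) _.
rewrite -[X in X * _ <= _]card_ord -sum_nat_const; apply: leq_sum => i _.
by rewrite -(sum_cyc_dist i); apply: leq_sum => j _; apply: cyc_dist_le.
Qed.
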